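(* For every $\varepsilon>0$ there exist $\delta>0$ and an integer $n_0=n_0(\delta,\varepsilon)$ such that the following holds. Suppose that $H$ is a graph on vertex set $V(K_n)$ with $n\geq n_0$, $\Delta(H)\leq \delta n$, and $e(H)\leq \frac{n^2}{\ln n}$. Then for every positive integer $b\leq (1-\varepsilon)\frac{n}{\ln n}$, in the $(1:b)$ Maker-Breaker game played on $E(K_n\setminus H)$, Maker can build a Hamilton cycle (of $K_n$) in $O(n)$ moves.
   Context: A $(1:b)$ Maker-Breaker game on an edge set $E$: two players, Maker and Breaker, alternately claim previously unclaimed elements of $E$, with Breaker going first; in each move Breaker claims $b$ unclaimed edges and Maker claims one unclaimed edge. $K_n\setminus H$ denotes the graph on the $n$ vertices of $K_n$ whose edges are those of $K_n$ not in $H$. $\Delta(H)$ is the maximum degree of $H$, $e(H)$ its number of edges, and $\ln$ the natural logarithm. ''In $O(n)$ moves'' means within at most $Kn$ Maker moves for some absolute constant $K$. *)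

(* Defs.v *)
From mathcomp Require Import all_boot all_order all_algebra.
From mathcomp Require Import reals exp.

Set Implicit Arguments.
Unset Strict Implicit.
Unset Printing Implicit Defensive.

(* A simple graph on the vertex type V is given by its set of edges, each edge
   being a set of two vertices. *)

Section Graphs.
Variable V : finType.

Definition complete_edges : {set {set V}} :=
  [set e : {set V} | #|e| == 2].

Definition is_graph (H : {set {set V}}) : bool := H \subset complete_edges.

Definition degree (H : {set {set V}}) (v : V) : nat :=
  #|[set e in H | v \in e]|.

Definition max_degree (H : {set {set V}}) : nat := \max_(v : V) degree H v.

Definition adjacent (G : {set {set V}}) : rel V :=
  fun x y => (x != y) && ([set x; y] \in G).

(* The size condition excludes the degenerate "cycles" that mathcomp's [cycle]
   accepts on fewer than three vertices. *)
Definition hamiltonian_cycle (G : {set {set V}}) (s : seq V) : Prop :=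
  [/\ 2 < size s, size s = #|V| & ucycle (adjacent G) s].

Definition has_hamiltonian_cycle (G : {set {set V}}) : Prop :=
  exists s : seq V, hamiltonian_cycle G s.

End Graphs.

Section MakerBreaker.
Variables (T : finType) (board : {set T}) (b : nat) (goal : {set T} -> Prop).

Definition unclaimed (M B : {set T}) : {set T} := board :\: (M :|: B).

(* Breaker claims exactly b elements, or all the remaining ones if fewer than
   b are left. *)
Definition breaker_move (M B D : {set T}) : bool :=
  (D \subset unclaimed M B) && (#|D| == minn b #|unclaimed M B|).

(* From the position where Maker owns M, Breaker owns B and Breaker is to move,
   Maker can force his set to satisfy the goal within at most k further moves
   of his own. If Breaker takes all that is left, Maker has no answer. *)
Fixpoint maker_forces (k : nat) (M B : {set T}) : Prop :=
  goal M \/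
  if k is k'.+1 then
    forall D : {set T}, breaker_move M B D ->
    exists2 e : T, e \in unclaimed M (B :|: D) &
                   maker_forces k' (e |: M) (B :|: D)
  else False.

Definition maker_can_build_within (k : nat) : Prop :=
  maker_forces k set0 set0.

End MakerBreaker.

(* Main.v *)
(** As in Krivelevich's proof, Maker first builds an expander and then enlarges
    a longest path until it closes up to a Hamilton cycle.

    Expander.  While some vertex has chosen fewer than four neighbours, Maker
    takes the one of largest danger (claimed or missing edges at it, minus
    2(b+1) per choice already made) and chooses a free neighbour for it.
    Gebauer and Szabo's averaging argument bounds the danger; it is run here
    forwards, as an invariant on the total danger of every set of active
    vertices, and leaves each vertex linearly many free neighbours.  If they were
    chosen at random, the expected number of pairs A <= W with |W| = 3|A| that
    trap all choices of A in W would be below 1; choosing them so that the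
    conditional expectation never grows derandomizes this, and in the end
    every small A satisfies |A u N(A)| > 3|A|.

    Hamilton cycle.  By Posa's lemma a longest path of l vertices in an expander
    that lies on no cycle of length l has quadratically many boosters, and a cycle of
    length l < n either extends to a path on l + 1 vertices or bounds a
    quadratic cut without edges of Maker.  Breaker's edges and H together are
    o(n^2), so two moves per vertex suffice. *)

Require Import Defs.
From mathcomp Require Import all_boot all_order all_algebra.
From mathcomp Require Import boolp reals exp.
From mathcomp Require sequences.
From mathcomp Require Import zify ring lra.
Set Implicit Arguments.
Unset Strict Implicit.
Unset Printing Implicit Defensive.

(** * Counting edges *)

Section EdgeCounting.
Variable V : finType.
Implicit Types (X Y : {set {set V}}) (J : {set V}) (v : V).

Lemma cardsU_le (T : finType) (A B : {set T}) : #|A :|: B| <= #|A| + #|B|.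
Proof. by rewrite leq_card_setU. Qed.

Lemma adjacent_sym X : symmetric (adjacent X).
Proof. by move=> x y; rewrite /adjacent eq_sym setUC. Qed.

Lemma set2_inj v : injective (fun u => [set v; u]).
Proof.
move=> u u' /= E.
have : u \in [set v; u'] by rewrite -E !inE eqxx orbT.
have : u' \in [set v; u] by rewrite E !inE eqxx orbT.
by rewrite !inE => /orP[/eqP->|/eqP->//] /orP[]/eqP.
Qed.

Lemma degreeE X v : degree X v = \sum_(e in X) (v \in e).
Proof. by rewrite /degree -sum1_card big_mkcond [RHS]big_mkcond; apply: eq_bigr => e _; rewrite !inE; case: (e \in X); case: (v \in e). Qed.

Lemma sum_degree X J : \sum_(v in J) degree X v = \sum_(e in X) #|e :&: J|.
Proof.
under eq_bigr do rewrite degreeE.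
rewrite exchange_big; apply: eq_bigr => e _ /=.
by rewrite -sum1_card big_mkcond [RHS]big_mkcond; apply: eq_bigr => v _; rewrite inE; case: (v \in e); case: (v \in J).
Qed.

Lemma degreeU X Y v : degree (X :|: Y) v <= degree X v + degree Y v.
Proof.
rewrite /degree; apply: leq_trans (cardsU_le _ _).
by apply/subset_leq_card/subsetP => e; rewrite !inE; case: (v \in e); rewrite ?andbF ?andbT.
Qed.

Lemma sum_degree_le X J : X \subset complete_edges V ->
  \sum_(v in J) degree X v <= 2 * #|X|.
Proof.
move=> /subsetP sX; rewrite sum_degree mulnC -sum_nat_const.
apply: leq_sum => e /sX; rewrite inE => /eqP <-.
by apply/subset_leq_card/subsetIl.
Qed.

Lemma star_degree X v (Z : {set V}) :
  {in Z, forall z, [set v; z] \in X} -> #|Z| <= degree X v.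
Proof.
move=> hZ; rewrite -(card_imset (mem Z) (@set2_inj v)) /degree.
apply/subset_leq_card/subsetP => _ /imsetP[z zZ ->].
by rewrite !inE hZ // eqxx.
Qed.

Lemma many_stars X k J : X \subset complete_edges V -> k < #|J| ->
  {in J, forall y, exists2 Z : {set V}, k < #|Z| & {in Z, forall z, [set y; z] \in X}} ->
  k.+1 * k.+1 <= 2 * #|X|.
Proof.
move=> sX kJ hJ; apply: leq_trans (sum_degree_le J sX).
apply: (@leq_trans (\sum_(v in J) k.+1)); first by rewrite sum_nat_const leq_mul.
by apply: leq_sum => y /hJ[Z kZ /star_degree]; apply: leq_trans.
Qed.

End EdgeCounting.

(** * Rotations of longest paths *)

Section Rotations.
Variables (V : finType) (M : {set {set V}}).
Implicit Types (p q s t : seq V).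
Local Notation adj := (adjacent M).

Fixpoint path_edges p : seq {set V} :=
  if p is x :: p' then
    if p' is y :: _ then [set x; y] :: path_edges p' else [::]
  else [::].

Lemma head_rev x p : head x (rev p) = last x p.
Proof. by case/lastP: p => // p y; rewrite rev_rcons last_rcons. Qed.

Lemma path_edges_cons x y p :
  path_edges (x :: y :: p) = [set x; y] :: path_edges (y :: p).
Proof. by []. Qed.

Lemma path_edges_cat s x t :
  path_edges (s ++ x :: t) = path_edges (rcons s x) ++ path_edges (x :: t).
Proof. by elim: s => [//|y s IH]; case: s IH => [//|z s] /= ->. Qed.

Lemma path_edges_rev p : path_edges (rev p) =i path_edges p.
Proof.
elim: p => [|x [|y p] IH] // e.
rewrite rev_cons rev_cons -!cats1 -catA /= path_edges_cat -rev_cons.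
by rewrite mem_cat IH orbC /= !inE setUC; case: (e == _).
Qed.

Lemma path_edges_sub p e a : e \in path_edges p -> a \in e -> a \in p.
Proof.
elim: p => [|x [|y p] IH] //; rewrite path_edges_cons in_cons => /orP[/eqP->|he ae].
  by rewrite !inE => /orP[]/eqP->; rewrite eqxx ?orbT.
by rewrite in_cons IH ?orbT.
Qed.

Lemma path_edges_head a y t : y \notin t -> [set a; y] \in path_edges (y :: t) -> a = head y t.
Proof.
case: t => [|z t] // yt; rewrite path_edges_cons in_cons => /orP[/eqP|he].
  by rewrite setUC => /set2_inj.
by have /(_ y) := path_edges_sub he; rewrite !inE eqxx orbT => /(_ isT) h; move: yt; rewrite inE h.
Qed.

Lemma card_path_neighbors p y : uniq p -> #|[set a | [set a; y] \in path_edges p]| <= 2.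
Proof.
move=> up; have [yp|yp] := boolP (y \in p); last first.
  rewrite (_ : [set a | _] = set0) ?cards0 //; apply/setP => a; rewrite !inE.
  by apply: contraNF yp => /path_edges_sub; apply; rewrite !inE eqxx orbT.
case/splitPr: yp up => s t; rewrite cat_uniq /= negb_or => /and3P[us /andP[ys _] /andP[yt _]].
apply: (@leq_trans #|[set head y t; last y s]|); last by rewrite cards2; case: (_ != _).
apply/subset_leq_card/subsetP => a; rewrite inE path_edges_cat mem_cat !inE => /orP[].
  rewrite -path_edges_rev rev_rcons => /path_edges_head ->; first by rewrite head_rev eqxx orbT.
  by rewrite mem_rev.
by move/path_edges_head => ->; rewrite ?eqxx.
Qed.

Inductive rotation p : seq V -> Prop :=
| RotationRefl : rotation p p
| RotationStep s w z t of rotation p (s ++ w :: z :: t) & adj (last z t) w :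
    rotation p (s ++ w :: rev (z :: t)).

Lemma rotation_perm p q : rotation p q -> perm_eq p q.
Proof.
elim=> // s w z t _ /perm_trans + _; apply.
by rewrite perm_cat2l perm_cons -(perm_rev (z :: t)) .
Qed.

Lemma rotation_sorted p q : sorted adj p -> rotation p q -> sorted adj q.
Proof.
move=> sp; elim=> // s w z t _ IH uw.
have E u : sorted adj (s ++ w :: u) = sorted adj (rcons s w) && path adj w u.
  by case: s {IH} => //= x s; rewrite -cat_rcons cat_path last_rcons.
move: IH; rewrite !E => /andP[-> /=] /andP[_ szt].
rewrite -[path _ _ _]/(sorted adj (w :: rev (z :: t))) -rev_rcons rev_sorted.
rewrite (eq_sorted (e' := adj)) => [|x y]; last exact: adjacent_sym.
by rewrite /= rcons_path szt.
Qed.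

Lemma rotation_head p q x : rotation p q -> head x q = head x p.
Proof. by elim=> // -[|y s] w z t _ IH _ //=. Qed.

Definition rotation_ends x p : {set V} :=
  [set y | `[< exists2 q, rotation p q & last x q = y >]].

Lemma rotation_endsP x p q : rotation p q -> last x q \in rotation_ends x p.
Proof. by move=> pq; rewrite inE; apply/asboolP; exists q. Qed.

Lemma rotation_ends_pivot x p s w z t : rotation p (s ++ w :: z :: t) ->
  adj (last z t) w -> z \in rotation_ends x p.
Proof.
move=> pq uw; have := rotation_endsP x (RotationStep pq uw).
by rewrite rev_cons -rcons_cons -rcons_cat last_rcons.
Qed.

(* A vertex that is neither an end nor a neighbour on [p] of an end never
   loses a path edge: breaking [w z] makes [z] an end. *)
Lemma rotation_fixed_edges x p q a : rotation p q ->
  a \notin rotation_ends x p ->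
  {in rotation_ends x p, forall y, [set a; y] \notin path_edges p} ->
  forall c, ([set a; c] \in path_edges q) = ([set a; c] \in path_edges p).
Proof.
move=> + aS aN; elim=> // s w z t pq IH uw c; rewrite -IH.
have zS : z \in rotation_ends x p := rotation_ends_pivot x pq uw.
have uS : last z t \in rotation_ends x p.
  by have := rotation_endsP x pq; rewrite last_cat /=.
have aw : a != w.
  apply/eqP => aw; have := aN _ zS; rewrite -IH path_edges_cat mem_cat.
  by rewrite /= inE aw eqxx orbT.
have az : a != z by apply: contraNneq aS => ->.
have au : a != last z t by apply: contraNneq aS => ->.
rewrite (path_edges_cat s w (rev _)) (path_edges_cat s w (z :: t)) !mem_cat; congr orb.
have nW d : a != d -> ([set a; c] == [set w; d]) = false.
  by move=> ad; apply/eqP => /setP/(_ a); rewrite !inE eqxx (negbTE aw) (negbTE ad).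
rewrite path_edges_cons in_cons nW //=.
rewrite -(path_edges_rev (z :: t)); have := head_rev w (z :: t).
case: (rev (z :: t)) (size_rev (z :: t)) => [//|y r] _ /= ->.
by rewrite in_cons nW.
Qed.

Definition neighborhood (A : {set V}) : {set V} :=
  [set y | [exists x in A, adj x y]].

Definition expander k : Prop := forall A : {set V},
  0 < #|A| <= k -> 3 * #|A| < #|A :|: neighborhood A|.

Definition longest p : Prop := [/\ sorted adj p, uniq p &
  forall q, sorted adj q -> uniq q -> size q <= size p].

Lemma longest_rotation p q : longest p -> rotation p q -> longest q.
Proof.
move=> [sp up mp] pq; have pe := rotation_perm pq.
split; first exact: rotation_sorted pq.
- by rewrite -(perm_uniq pe).
- by move=> r sr ur; rewrite -(perm_size pe) mp.
Qed.

Lemma longest_rev p : longest p -> longest (rev p).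
Proof.
move=> [sp up mp]; split; rewrite ?rev_uniq //.
- rewrite rev_sorted (eq_sorted (e' := adj)) // => x y; exact: adjacent_sym.
- by move=> r sr ur; rewrite size_rev mp.
Qed.

Lemma posa x p k : expander k -> 0 < size p -> longest p -> k < #|rotation_ends x p|.
Proof.
move=> ex p0 lp; set S := rotation_ends x p; rewrite ltnNge; apply/negP => Sk.
have S0 : 0 < #|S| by apply/card_gt0P; exists (last x p); apply: rotation_endsP; constructor.
have [_ up _] := lp.
pose N := \bigcup_(y in S) [set a | [set a; y] \in path_edges p].
have NS : #|N| <= 2 * #|S|.
  rewrite mulnC -sum_nat_const /N.
  elim/big_ind2: _ => [|A n B n' An Bn'|y _]; first by rewrite cards0.
    by apply: leq_trans (cardsU_le _ _) _; apply: leq_add.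
  exact: card_path_neighbors.
have sN : S :|: neighborhood S \subset S :|: N.
  apply/subsetP => a; rewrite in_setU => /orP[aS|]; first by rewrite in_setU aS.
  rewrite inE => /exists_inP[y]; rewrite inE => /asboolP[q pq <-] {y} ya.
  apply: contraT; rewrite in_setU negb_or => /andP[aS aN].
  have aN' : {in S, forall y, [set a; y] \notin path_edges p}.
    by move=> y yS; apply: contraNN aN => h; apply/bigcupP; exists y => //; rewrite inE.
  have [sq uq mq] := longest_rotation lp pq.
  have aq : a \in q.
    have q0 : 0 < size q by rewrite -(perm_size (rotation_perm pq)).
    apply/negP => /negP aq; have := mq (rcons q a).
    rewrite size_rcons ltnn rcons_uniq aq uq; case: q {pq mq uq aq} q0 ya sq => //= y q _ ya sq.
    by rewrite rcons_path sq ya => /(_ isT isT).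
  case/splitPr: aq pq ya {sq uq mq} => s [|z t] pq; rewrite last_cat /=.
    by rewrite /adjacent eqxx.
  move=> ya; have zS := rotation_ends_pivot x pq ya.
  have := aN' _ zS; rewrite -(rotation_fixed_edges pq aS aN').
  by rewrite path_edges_cat mem_cat /= inE eqxx orbT.
have := ex S; rewrite S0 Sk => /(_ isT); apply/negP; rewrite -leqNgt.
apply: leq_trans (subset_leq_card sN) _; apply: leq_trans (cardsU_le _ _) _; lia.
Qed.
End Rotations.

Section PathsAndCycles.
Variables (V : finType) (k : nat).
Implicit Types (M : {set {set V}}) (p q s : seq V).

Definition has_path M l : Prop :=
  exists p, [/\ sorted (adjacent M) p, uniq p & size p = l].

Definition has_cycle M l : Prop :=
  exists s, [/\ 2 < size s, ucycle (adjacent M) s & size s = l].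

Lemma sub_adjacent M M' : M \subset M' -> subrel (adjacent M) (adjacent M').
Proof. by move=> /subsetP sM x y /andP[xy /sM]; rewrite /adjacent xy. Qed.

Lemma sub_expander M M' : M \subset M' -> expander M k -> expander M' k.
Proof.
move=> sM ex A /ex /leq_trans; apply; apply/subset_leq_card/setUS/subsetP => y.
rewrite !inE => /exists_inP[x xA xy]; apply/exists_inP; exists x => //.
exact: sub_adjacent xy.
Qed.

Lemma cycle_extend M s x y : ucycle (adjacent M) s -> x \in s -> y \notin s ->
  adjacent M x y -> has_path M (size s).+1.
Proof.
move=> /andP[cs us] xs ys xy; have [i s' E] := rot_to xs.
exists (y :: rot i s); split; last by rewrite /= size_rot.
- move: cs; rewrite -(rot_cycle i) E /= rcons_path => /andP[-> _].
  by rewrite adjacent_sym xy.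
- by rewrite /= rot_uniq us mem_rot ys.
Qed.

Lemma close_path M M' p x : sorted (adjacent M) p -> uniq p -> 2 < size p ->
  M \subset M' -> [set head x p; last x p] \in M' -> has_cycle M' (size p).
Proof.
move=> sp up sz sM hM; exists p; split=> //; rewrite /ucycle up andbT.
case: p sp up sz hM => [//|y p] /= sp /andP[yp up] sz hM.
rewrite rcons_path (sub_path (sub_adjacent sM) sp) /= adjacent_sym /adjacent hM andbT.
case: p {sp up hM} sz yp => [//|z p] _ yp; apply: contraNneq yp => E; rewrite {1}E (mem_last z p) //.
Qed.

Lemma sorted_take_path M l p : sorted (adjacent M) p -> uniq p -> l <= size p ->
  has_path M l.
Proof.
move=> sp up lp; exists (take l p).
by rewrite take_uniq // take_sorted // size_takel.
Qed.

Lemma expander_closed_card M (A : {set V}) : expander M k -> 0 < #|A| ->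
  neighborhood M A \subset A -> k < #|A|.
Proof.
move=> ex A0 /setUidPl AN; rewrite ltnNge; apply/negP => Ak.
by have := ex A; rewrite A0 Ak AN => /(_ isT); lia.
Qed.

Lemma longest_size M p : 0 < size p -> expander M k -> longest M p -> k < size p.
Proof.
case: p => // x p _ ex lp; have := posa x ex _ lp => /(_ isT)/leq_trans; apply.
rewrite -(card_uniqP _); last by case: lp.
apply/subset_leq_card/subsetP => y; rewrite inE => /asboolP[q pq <-].
rewrite (perm_mem (rotation_perm pq)).
by case: q pq => [/rotation_perm/perm_size//|z q _]; exact: (mem_last z q).
Qed.

Lemma boosters M p x0 : 0 < size p -> expander M k -> longest M p ->
  exists2 Y : {set V}, k < #|Y| &
  {in Y, forall y, exists2 Z : {set V}, k < #|Z| & {in Z, forall z,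
    exists r, [/\ longest M r, size r = size p, head x0 r = y & last x0 r = z]}}.
Proof.
move=> p0 ex lp; exists (rotation_ends M x0 p); first exact: posa.
move=> y; rewrite inE => /asboolP[q pq qy].
have lq := longest_rev (longest_rotation lp pq).
have sq : size (rev q) = size p by rewrite size_rev (perm_size (rotation_perm pq)).
exists (rotation_ends M x0 (rev q)); first by apply: posa => //; rewrite sq.
move=> z; rewrite inE => /asboolP[r qr rz].
exists r; split=> //; first exact: longest_rotation qr.
  by rewrite -sq (perm_size (rotation_perm qr)).
by rewrite (rotation_head _ qr) head_rev.
Qed.

End PathsAndCycles.

(** * The endgame *)

Section MakerGames.
Variables (T : finType) (board : {set T}) (b : nat) (goal : {set T} -> Prop).

Lemma maker_forcesS k M B :
  maker_forces board b goal k M B -> maker_forces board b goal k.+1 M B.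
Proof.
elim: k M B => [|k IH] M B; first by case=> // g; left.
case=> [g|h]; first by left.
right=> D /h[e eu f]; exists e => //; exact: IH.
Qed.

Lemma maker_forces_leq k k' M B : k <= k' ->
  maker_forces board b goal k M B -> maker_forces board b goal k' M B.
Proof.
move=> /subnK <-; elim: (k' - k) => // d IH /IH; rewrite addSn.
exact: maker_forcesS.
Qed.

End MakerGames.

Lemma budget b h x y e c : y <= x + b -> 2 * (h + x + b * e.+1) < c ->
  2 * (h + y + b * e) < c.
Proof. by rewrite mulnS; lia. Qed.

Section Endgame.
Variables (V : finType) (H : {set {set V}}) (b k : nat).
Hypotheses (sH : H \subset complete_edges V) (k_gt1 : 1 < k).
Local Notation board := (complete_edges V :\: H).
Local Notation forces := (maker_forces board b (@has_hamiltonian_cycle V)).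
Implicit Types (M B D : {set {set V}}).

Lemma breaker_moveP M B D : breaker_move board b M B D ->
  [/\ D \subset complete_edges V, #|D| <= b & #|H :|: (B :|: D)| <= #|H| + #|B| + b].
Proof.
case/andP=> /subsetP sD /eqP cD.
have Db : #|D| <= b by rewrite cD geq_minl.
split=> //; first by apply/subsetP => e /sD; rewrite 3!inE => /and3P[].
rewrite -addnA; apply: leq_trans (cardsU_le _ _) _; rewrite leq_add2l.
by apply: leq_trans (cardsU_le _ _) _; rewrite leq_add2l.
Qed.

Lemma unclaimedP M B e : e \in complete_edges V -> e \notin H :|: B -> e \notin M ->
  e \in unclaimed board M B.
Proof. by rewrite !inE !negb_or => -> /andP[-> ->] ->. Qed.

Lemma find_open_pair (X : {set {set V}}) (Y : {set V}) (P : V -> V -> Prop) :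
  X \subset complete_edges V -> 2 * #|X| < k.+1 * k.+1 -> k < #|Y| ->
  {in Y, forall y, exists2 Z : {set V}, k < #|Z| & {in Z, forall z, P y z}} ->
  exists y z, [/\ y \in Y, P y z & [set y; z] \notin X].
Proof.
move=> sX cX kY hY; apply: contrapT => no.
suff : k.+1 * k.+1 <= 2 * #|X| by rewrite leqNgt cX.
apply: many_stars kY _ => // y yY; have [Z kZ hZ] := hY y yY.
exists Z => // z zZ; apply: contraT => yz; case: no.
by exists y, z; split=> //; exact: hZ.
Qed.

Lemma edge_complete (x y : V) : x != y -> [set x; y] \in complete_edges V.
Proof. by rewrite inE cards2 => ->. Qed.

Lemma endgame_cycle d M B : B \subset complete_edges V -> expander M k ->
  (forall M' B', B' \subset complete_edges V -> expander M' k ->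
     has_path M' (#|V| - d) -> 2 * (#|H| + #|B'| + b * (2 * d).+1) < k.+1 * k.+1 ->
     forces (2 * d).+1 M' B') ->
  has_cycle M (#|V| - d.+1) -> d.+1 < #|V| ->
  2 * (#|H| + #|B| + b * (2 * d.+1)) < k.+1 * k.+1 -> forces (2 * d.+1) M B.
Proof.
move=> sB ex IH [s [s2 us ss]] dV cB.
have sV : (size s).+1 = #|V| - d by rewrite ss; lia.
pose C := [set x in s].
have cC : #|C| = size s by rewrite cardsE; apply/card_uniqP; case/andP: us.
have [[x [y [xs ys xy]]]|closed] := pselect (exists x y, [/\ x \in s, y \notin s & adjacent M x y]).
  have p := cycle_extend us xs ys xy; rewrite sV in p.
  by apply: (maker_forces_leq (k := (2 * d).+1)); [lia|apply: IH => //; lia].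
have Ck : k < #|C|.
  apply: expander_closed_card ex _ _; first by rewrite cC; lia.
  apply/subsetP => y; rewrite !inE => /exists_inP[x]; rewrite inE => xs xy.
  by apply: contraT => ys; case: closed; exists x, y.
have CCk : k < #|~: C|.
  apply: expander_closed_card ex _ _; first by rewrite cardsCs setCK cC; lia.
  apply/subsetP => y; rewrite !inE => /exists_inP[x]; rewrite !inE => xs xy.
  by apply/negP => ys; case: closed; exists y, x; rewrite adjacent_sym.
rewrite mulnS in cB *; right => D /breaker_moveP[sD Db cD].
have sX : H :|: (B :|: D) \subset complete_edges V by rewrite !subUset sH sB.
have cX : 2 * #|H :|: (B :|: D)| < k.+1 * k.+1 by apply: leq_ltn_trans cB; lia.
have hY : {in C, forall y, exists2 Z : {set V}, k < #|Z| & {in Z, forall z, z \notin s}}.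
  by move=> y _; exists (~: C) => // z; rewrite !inE.
have [x [y [xC yC xyX]]] := find_open_pair sX cX Ck hY.
have xy : x != y by move: xC; rewrite inE; apply: contraTneq => ->.
have xyM : [set x; y] \notin M.
  apply/negP => h; case: closed; exists x, y; split=> //; first by move: xC; rewrite inE.
  by rewrite /adjacent xy.
exists [set x; y]; first by apply: unclaimedP => //; exact: edge_complete.
have sM : M \subset [set x; y] |: M by exact: subsetUr.
apply: IH.
- by rewrite subUset sB.
- exact: sub_expander ex.
- rewrite -sV; move: xC; rewrite inE => xs.
  case/andP: us => cs us; apply: (cycle_extend (x := x) (y := y)) => //.
    by rewrite /ucycle us andbT; apply: sub_cycle cs; exact: sub_adjacent.
  by rewrite /adjacent xy in_setU inE eqxx.
- by apply: budget cB; apply: leq_trans (cardsU_le _ _) _; rewrite leq_add2l.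
Qed.

Lemma endgame_path d M B : B \subset complete_edges V -> expander M k ->
  d < #|V| ->
  (forall M' B', B' \subset complete_edges V -> expander M' k ->
     has_cycle M' (#|V| - d) -> 2 * (#|H| + #|B'| + b * (2 * d)) < k.+1 * k.+1 ->
     forces (2 * d) M' B') ->
  (has_path M (#|V| - d).+1 -> forces (2 * d).+1 M B) ->
  has_path M (#|V| - d) ->
  2 * (#|H| + #|B| + b * (2 * d).+1) < k.+1 * k.+1 -> forces (2 * d).+1 M B.
Proof.
move=> sB ex dV IHc IHp [p [sp up szp]] cB.
have [/IHp//|nolonger] := pselect (has_path M (#|V| - d).+1).
have lp : longest M p.
  split=> // q sq uq; rewrite leqNgt; apply/negP; rewrite szp => lt.
  by case: nolonger; apply: sorted_take_path sq uq lt.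
have p0 : 0 < size p by lia.
have p2 : 2 < size p by exact: leq_ltn_trans k_gt1 (longest_size p0 ex lp).
have [x0 _] : exists x0 : V, True by case: p p0 {p2 lp sp up szp} => // x0 *; exists x0.
have [cyc|nocycle] := pselect (has_cycle M (#|V| - d)).
  by apply/maker_forcesS/IHc => //; lia.
right => D /breaker_moveP[sD Db cD].
have sX : H :|: (B :|: D) \subset complete_edges V by rewrite !subUset sH sB.
have [Y kY hY] := boosters x0 p0 ex lp.
have cX : 2 * #|H :|: (B :|: D)| < k.+1 * k.+1 by apply: leq_ltn_trans cB; lia.
have [x [y [_ [r [[sr ur _] szr rx ry]] xyX]]] := find_open_pair sX cX kY hY.
have [hx hy] : head x r = x /\ last x r = y.
  by rewrite -rx -ry; case: r {sr ur rx ry} szr => //=; move: p0; case: p {p2 lp sp up szp hY}.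
have xyM : [set x; y] \notin M.
  apply/negP => h; case: nocycle; rewrite -szp -szr.
  by apply: (close_path (M := M) (x := x)) => //; rewrite ?szr // hx hy.
have xy : x != y.
  rewrite -hx -hy; case: r {sr rx ry hx hy} ur szr => [|z [|z' r]] /= + E; rewrite -?E // in p2 *.
  case/andP=> h _; apply: contraNneq h => {1}->; exact: (mem_last z' r).
have sM : M \subset [set x; y] |: M by exact: subsetUr.
exists [set x; y]; first by apply: unclaimedP => //; exact: edge_complete.
apply: IHc.
- by rewrite subUset sB.
- exact: sub_expander ex.
- rewrite -szp -szr; apply: (close_path (M := M) (x := x)) => //; first by rewrite szr.
  by rewrite hx hy in_setU inE eqxx.
- by apply: budget cB; apply: leq_trans (cardsU_le _ _) _; rewrite leq_add2l.
Qed.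

Lemma endgame d M B : B \subset complete_edges V -> expander M k -> d < #|V| ->
  (has_path M (#|V| - d) ->
     2 * (#|H| + #|B| + b * (2 * d).+1) < k.+1 * k.+1 -> forces (2 * d).+1 M B) /\
  (has_cycle M (#|V| - d) ->
     2 * (#|H| + #|B| + b * (2 * d)) < k.+1 * k.+1 -> forces (2 * d) M B).
Proof.
elim: d M B => [|d IH] M B sB ex dV.
- have cyc M' B' : has_cycle M' (#|V| - 0) -> forces 0 M' B'.
    by case=> s [s2 us ss]; left; exists s; split=> //; rewrite ss subn0.
  split; last by move=> h _; apply: cyc.
  apply: endgame_path => //; first by move=> *; exact: cyc.
  case=> p [_ up]; rewrite subn0 => szp.
  by have := uniq_leq_size up (fun x _ => mem_enum V x); rewrite szp -cardE ltnn.
- have cyc M' B' : B' \subset complete_edges V -> expander M' k ->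
    has_cycle M' (#|V| - d.+1) -> 2 * (#|H| + #|B'| + b * (2 * d.+1)) < k.+1 * k.+1 ->
    forces (2 * d.+1) M' B'.
    move=> sB' ex' hc cB'; apply: (endgame_cycle sB' ex' _ hc dV cB') => M2 B2 sB2 ex2.
    by apply IH => //; exact: ltnW.
  split=> [hp cB|]; last exact: cyc.
  apply: endgame_path => // hp'.
  apply: (maker_forces_leq (k := (2 * d).+1)); first by lia.
  have [IHp _] := IH M B sB ex (ltnW dV); apply: IHp; last by lia.
  by move: hp'; rewrite subnSK // ltnW.
Qed.

End Endgame.

(** * The danger invariant *)

Section Danger.
Import Order.TTheory GRing.Theory Num.Theory.
Local Open Scope ring_scope.
Variables (V : finType) (R : realType) (b m : nat) (f1 f2 : nat -> R).
Implicit Types (C D X : {set {set V}}) (J : {set V}) (v u : V).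
Implicit Types (out : {ffun V -> {set V}}).

Definition touching X J : nat := #|[set e in X | ~~ [disjoint e & J]]|.

Definition danger C out v : R :=
  (degree C v)%:R - (2 * b.+1 * #|out v|)%N%:R.

Definition active out : {set V} := [set v | #|out v| < 4]%N.

(* Two bounds on the total danger of every set [J] of active vertices.  For
   small [J] the first is too weak, as it charges each of Breaker's edges
   twice; the second charges it once, which costs at most [#|J|] for the edges
   inside [J] whenever a vertex leaves [J]. *)
Definition safe C out : Prop :=
  (forall J, J \subset active out -> (m <= #|J|)%N ->
     \sum_(v in J) danger C out v <= #|J|%:R * f1 #|J|) /\
  (forall J, J \subset active out -> (0 < #|J| <= m)%N ->
     (touching C J)%:R - (2 * b.+1 * \sum_(v in J) #|out v|)%N%:R <= #|J|%:R * f2 #|J|).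

Lemma touchingU X D J : (touching (X :|: D) J <= touching X J + #|D|)%N.
Proof.
apply: leq_trans (cardsU_le _ _); apply/subset_leq_card/subsetP => e; rewrite !inE.
by case/andP=> /orP[->->//|->]; rewrite orbT.
Qed.

Lemma touching_degree X J : (touching X J <= \sum_(v in J) degree X v)%N.
Proof.
rewrite sum_degree /touching -sum1_card big_mkcond [leqRHS]big_mkcond.
apply: leq_sum => e _; rewrite inE; case: (e \in X) => //=.
by rewrite -setI_eq0 -card_gt0; case: #|_|.
Qed.

Lemma touchingU1 X J v : X \subset complete_edges V -> v \notin J ->
  (degree X v + touching X J <= touching X (v |: J) + #|J|)%N.
Proof.
move=> /subsetP sX vJ; rewrite /degree /touching -cardsUI; apply: leq_add.
  apply/subset_leq_card/subsetP => e; rewrite !inE -!setI_eq0.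
  case: (e \in X) => //= /orP[ve|].
    by apply/set0Pn; exists v; rewrite !inE ve eqxx.
  by case/set0Pn=> u; rewrite inE => /andP[ue uJ]; apply/set0Pn; exists u; rewrite !inE ue uJ orbT.
apply: leq_trans (leq_imset_card (fun u => [set v; u]) (mem J)).
apply/subset_leq_card/subsetP => e; rewrite !inE -!setI_eq0 => /andP[/andP[eX ve] /andP[_]].
case/set0Pn=> u; rewrite inE => /andP[ue uJ]; apply/imsetP; exists u => //.
apply/esym/eqP; rewrite eqEcard subUset !sub1set ve ue /=.
have := sX _ eX; rewrite inE => /eqP ->; rewrite cards2.
by case: eqP vJ uJ => // <- /negP.
Qed.

Lemma sum_danger C out J : \sum_(v in J) danger C out v =
  (\sum_(v in J) degree C v)%N%:R - (2 * b.+1 * \sum_(v in J) #|out v|)%N%:R.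
Proof.
by rewrite /danger sumrB big_distrr /= !natr_sum.
Qed.

Lemma sum_degreeU C D J : D \subset complete_edges V ->
  (\sum_(v in J) degree (C :|: D) v <= \sum_(v in J) degree C v + 2 * #|D|)%N.
Proof.
move=> sD; apply: leq_trans (_ : _ <= \sum_(v in J) (degree C v + degree D v))%N _.
  by apply: leq_sum => v _; exact: degreeU.
by rewrite big_split leq_add2l sum_degree_le.
Qed.

Lemma degree1 v u J : v \notin J ->
  (\sum_(x in J) degree [set [set v; u]] x <= 1)%N.
Proof.
move=> vJ; rewrite sum_degree big_set1 -(cards1 u).
apply/subset_leq_card/subsetP => x; rewrite !inE => /andP[/orP[/eqP->|//]].
by rewrite (negbTE vJ).
Qed.

Lemma average_le (X g F c : R) j : X <= j%:R * g ->
  g + X <= j.+1%:R * F + c -> X <= j%:R * F + c * (j%:R / j.+1%:R).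
Proof.
move=> Xg gX; have j1 : (0 : R) < j.+1%:R by rewrite ltr0n.
have -> : j%:R * F + c * (j%:R / j.+1%:R) = j%:R * (j.+1%:R * F + c) / j.+1%:R.
  by field; rewrite nat1r pnatr_eq0.
rewrite ler_pdivlMr // -natr1 mulrDr mulr1 [X * _]mulrC.
by have := ler_wpM2l (ler0n R j) gX; rewrite -natr1; lra.
Qed.

Hypotheses (m_gt0 : (0 < m)%N) (f12 : f1 m <= f2 m).
Hypothesis f1S : forall j, (m <= j)%N -> (2 * b.+1)%N%:R <= j%:R * (f1 j - f1 j.+1).
Hypothesis f2S : forall j, (0 < j < m)%N ->
  1 + (b.+2)%:R / j.+1%:R <= f2 j - f2 j.+1.

Definition add_out out v u : {ffun V -> {set V}} :=
  [ffun x => if x == v then u |: out v else out x].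

Lemma card_add_out out v u x : u \notin out v ->
  #|add_out out v u x| = ((x == v) + #|out x|)%N.
Proof. by move=> uv; rewrite ffunE; case: eqP => [->|_] //; rewrite cardsU1 uv. Qed.

Lemma active_add_out out v u : u \notin out v -> active (add_out out v u) \subset active out.
Proof.
by move=> uv; apply/subsetP => x; rewrite !inE card_add_out //; apply: leq_trans; rewrite ltnS leq_addl.
Qed.

Lemma sum_add_out out v u J : u \notin out v ->
  (\sum_(x in J) #|add_out out v u x| = (v \in J) + \sum_(x in J) #|out x|)%N.
Proof.
move=> uv; under eq_bigr do rewrite card_add_out //.
rewrite big_split /=; congr addn; rewrite big_mkcond /=.
rewrite (bigD1 v) //= eqxx big1 => [|x /negbTE ->]; last by case: ifP.
by rewrite addn0; case: (v \in J).
Qed.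

Lemma safe_step C D out v u : C \subset complete_edges V -> D \subset complete_edges V ->
  (#|D| <= b)%N -> u != v -> u \notin out v -> v \in active out ->
  {in active out, forall x, danger (C :|: D) out x <= danger (C :|: D) out v} ->
  safe C out -> safe ([set v; u] |: (C :|: D)) (add_out out v u).
Proof.
move=> sC sD Db uv uo va vmax [I1 I2].
have se : [set [set v; u]] \subset complete_edges V.
  by rewrite sub1set edge_complete // eq_sym.
have sCD : C :|: D \subset complete_edges V by rewrite subUset sC.
pose C' := [set v; u] |: (C :|: D).
have J1 J : J \subset active (add_out out v u) -> (m <= #|J|)%N ->
    \sum_(x in J) danger C' (add_out out v u) x <= #|J|%:R * f1 #|J|.
  move=> /subset_trans/(_ (active_add_out uo)) sJ mJ; rewrite sum_danger sum_add_out //.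
  have := sum_degreeU C J sD.
  rewrite /C' (setUC [set [set v; u]]); have [vJ h1|vJ h1] := boolP (v \in J).
    have h2 := sum_degreeU (C :|: D) J se.
    apply: le_trans (I1 J sJ mJ); rewrite sum_danger lerBlDr addrAC lerBrDr -!natrD ler_nat.
    move: h1 h2 Db; rewrite cards1 mulnDr addnA leq_add2r [(2 * b.+1 * true)%N]muln1.
    move=> h1' h2' Db'; rewrite mulnS addnCA addnC; apply: (leq_trans h2').
    by rewrite leq_add2r; apply: (leq_trans h1'); rewrite leq_add2l leq_mul2l Db'.
  have h2 : (\sum_(x in J) degree (C :|: D :|: [set [set v; u]]) x <=
      \sum_(x in J) degree (C :|: D) x + 1)%N.
    apply: leq_trans (_ : _ <= \sum_(x in J) (degree (C :|: D) x + degree [set [set v; u]] x))%N _.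
      by apply: leq_sum => x _; exact: degreeU.
    by rewrite big_split leq_add2l degree1.
  have hv : \sum_(x in J) danger (C :|: D) out x <= #|J|%:R * danger (C :|: D) out v.
    rewrite mulr_natl -sumr_const; apply: ler_sum => x xJ; apply: vmax.
    exact: (subsetP sJ).
  have sJ' : v |: J \subset active out by rewrite subUset sub1set va.
  have cJ' : #|v |: J| = #|J|.+1 by rewrite cardsU1 vJ.
  have := I1 _ sJ'; rewrite cJ' => /(_ (leqW mJ)).
  have h3 := sum_degreeU C (v |: J) sD.
  have : \sum_(x in v |: J) danger (C :|: D) out x <= \sum_(x in v |: J) danger C out x + (2 * b)%N%:R.
    rewrite !sum_danger addrAC lerD2r -natrD ler_nat.
    by apply: leq_trans h3 _; rewrite leq_add2l leq_mul2l Db.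
  rewrite big_setU1 //= => h4 h5; rewrite add0n.
  rewrite sum_danger in hv; rewrite sum_danger in h4.
  have j0 : (0 : R) < #|J|%:R by rewrite ltr0n (leq_trans m_gt0).
  move: h2; rewrite -(ler_nat R) natrD => h2.
  have h6 := average_le hv (le_trans h4 (lerD h5 (lexx _))).
  have j1 : #|J|%:R / #|J|.+1%:R <= 1 :> R.
    by rewrite ler_pdivrMr ?ltr0n // mul1r ler_nat.
  have h7 := ler_wpM2l (ler0n R (2 * b)) j1.
  have := f1S mJ.
  have -> : (2 * b.+1)%N%:R = (2 * b)%N%:R + 2 :> R by rewrite mulnS natrD addrC.
  rewrite mulrBr => h8; rewrite lerBlDr; apply: le_trans h2 _; rewrite -lerBrDr.
  rewrite lerBlDr in h6; apply: le_trans h6 _.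
  rewrite mulr1 in h7; rewrite [leRHS]addrAC lerD2r.
  apply: le_trans (lerD (lexx _) h7) _; rewrite -lerBrDl; lra.
have W1 J : (touching C' J)%:R <= (touching (C :|: D) J)%:R + 1 :> R.
  rewrite natr1 ler_nat -addn1 -(cards1 [set v; u]) /C' (setUC [set [set v; u]]); exact: touchingU.
split=> // J sJ' /andP[J0 mJ].
have sJ := subset_trans sJ' (active_add_out uo).
rewrite sum_add_out //; have [vJ|vJ] := boolP (v \in J).
  apply: le_trans (I2 J sJ _); last by rewrite J0.
  rewrite lerBlDr addrAC lerBrDr -!natrD ler_nat.
  rewrite /C' (setUC [set [set v; u]]) mulnDr addnA leq_add2r.
  apply: leq_trans (touchingU _ _ _) _; rewrite cards1 [(2 * b.+1 * true)%N]muln1.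
  apply: leq_trans (leq_add (touchingU _ _ _) (leqnn _)) _; rewrite -addnA leq_add2l.
  by apply: (@leq_trans b.+1); rewrite ?leq_pmull // addn1 ltnS.
have [mJ'|Jm] := leqP m #|J|.
  have E : #|J| = m by apply/eqP; rewrite eqn_leq mJ.
  have h := J1 J sJ' mJ'; apply: le_trans (_ : _ <= #|J|%:R * f1 #|J|) _; last first.
    by rewrite E ler_wpM2l.
  apply: le_trans h; rewrite sum_danger sum_add_out // (negbTE vJ) lerD2r ler_nat.
  exact: touching_degree.
have j0 : (0 : R) < #|J|%:R by rewrite ltr0n.
have hv : \sum_(x in J) danger (C :|: D) out x <= #|J|%:R * danger (C :|: D) out v.
  rewrite mulr_natl -sumr_const; apply: ler_sum => x xJ; apply: vmax.
  exact: (subsetP sJ).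
pose W : R := (touching (C :|: D) J)%:R - (2 * b.+1 * \sum_(x in J) #|out x|)%N%:R.
have hW : W <= #|J|%:R * danger (C :|: D) out v.
  apply: le_trans hv; rewrite sum_danger lerD2r ler_nat; exact: touching_degree.
have sJv : v |: J \subset active out by rewrite subUset sub1set va.
have := I2 _ sJv; rewrite cardsU1 vJ add1n => /(_ Jm).
have : danger (C :|: D) out v + W <= (touching C (v |: J))%:R -
   (2 * b.+1 * \sum_(x in v |: J) #|out x|)%N%:R + (b + #|J|)%N%:R.
  rewrite /danger /W big_setU1 //= addrACA -opprD -!natrD -mulnDr.
  rewrite [leRHS]addrAC lerD2r -!natrD ler_nat.
  apply: leq_trans (touchingU1 sCD vJ) _; rewrite addnA leq_add2r.
  by apply: leq_trans (touchingU _ _ _) _; rewrite leq_add2l.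
move=> h1 h2; have {h1 h2} := average_le hW (le_trans h1 (lerD h2 (lexx _))).
have := W1 J; have Jm' : (0 < #|J| < m)%N by rewrite J0.
have := ler_wpM2l (ltW j0) (f2S Jm').
set i : R := #|J|.+1%:R^-1.
have ji : #|J|%:R * i = 1 - i.
  have : #|J|.+1%:R * i = 1 by rewrite /i mulfV // pnatr_eq0.
  by rewrite -natr1 mulrDl mul1r => /(canRL (addrK _)).
have i2 : i <= 2^-1 by rewrite lef_pV2 ?posrE ?ltr0n // ler_nat ltnS.
have bi : #|J|%:R * (1 + b.+2%:R * i) = #|J|%:R + b%:R * (1 - i) + 2 * (1 - i).
  by rewrite -ji -(addn2 b) natrD; ring.
rewrite bi ji natrD [X in _ <= X -> _]mulrBr /W.
have jj : #|J|%:R * (1 - i) = #|J|%:R - (1 - i) :> R by rewrite mulrBr mulr1 ji.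
rewrite (mulrDl b%:R #|J|%:R) jj => h1 h2 h3; rewrite lerBlDr; apply: le_trans h2 _.
rewrite -lerBrDr; rewrite lerBlDr in h3; apply: le_trans h3 _.
by rewrite [leRHS]addrAC lerD2r; lra.
Qed.

Lemma safe_init C d : C \subset complete_edges V -> (max_degree C)%:R <= d :> R ->
  (forall j, (m <= j <= #|V|)%N -> d <= f1 j) -> (forall j, (0 < j <= m)%N -> d <= f2 j) ->
  safe C [ffun _ => set0].
Proof.
move=> sC Cd d1 d2.
have s0 J : (\sum_(v in J) #|[ffun _ => set0 : {set V}] v| = 0)%N.
  by rewrite big1 // => v _; rewrite ffunE cards0.
have sJ J : (\sum_(v in J) degree C v)%N%:R <= #|J|%:R * d.
  rewrite natr_sum mulr_natl -sumr_const; apply: ler_sum => v _.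
  by apply: le_trans Cd; rewrite ler_nat; exact: leq_bigmax.
split=> J _ hJ.
  rewrite sum_danger s0 muln0 subr0; apply: le_trans (sJ J) _.
  by rewrite ler_wpM2l // d1 // hJ max_card.
rewrite s0 muln0 subr0; apply: le_trans (_ : _ <= (\sum_(v in J) degree C v)%N%:R) _.
  by rewrite ler_nat; exact: touching_degree.
by apply: le_trans (sJ J) _; rewrite ler_wpM2l // d2.
Qed.

Lemma safe_degree C out v : safe C out -> v \in active out ->
  (degree C v)%:R <= f2 1 + (8 * b.+1)%N%:R.
Proof.
case=> _ I2 va; have := I2 [set v]; rewrite sub1set va cards1 m_gt0 => /(_ isT isT).
rewrite big_set1 mul1r lerBlDr => h.
have hd : (degree C v <= touching C [set v])%N.
  apply/subset_leq_card/subsetP => e; rewrite !inE => /andP[-> ve] /=.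
  by rewrite -setI_eq0; apply/set0Pn; exists v; rewrite !inE ve eqxx.
apply: (le_trans (_ : _ <= (touching C [set v])%:R)); first by rewrite ler_nat.
apply: le_trans h _; rewrite lerD2l ler_nat mulnC mulnA leq_mul2r /=.
by move: va; rewrite inE; case: #|out v| => [|[|[|[|]]]].
Qed.
End Danger.

(** * The expansion potential *)

Section Counting.

Lemma expn_fact_le m j : m`! * m ^ j <= (m + j)`!.
Proof.
elim: j => [|j IH]; first by rewrite addn0 muln1.
by rewrite addnS factS expnS mulnCA leq_mul // leqW // leq_addr.
Qed.

Lemma bin_le_exp2 n m : 'C(n, m) <= 2 ^ n.
Proof.
have [le|lt] := leqP m n; last by rewrite bin_small.
have := expnDn 1 1 n; rewrite addn1 => ->.
by rewrite (bigD1 (Ordinal (le : m < n.+1))) //= !exp1n !muln1 leq_addr.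
Qed.

Lemma selfexp_le m : m ^ m <= 4 ^ m * m`!.
Proof.
rewrite -(leq_pmul2r (fact_gt0 m)) -mulnA mulnC.
apply: leq_trans (expn_fact_le m m) _.
rewrite -(@bin_fact (m + m) m) ?leq_addr // addKn leq_mul //.
by apply: leq_trans (bin_le_exp2 _ _) _; rewrite addnn -muln2 mulnC expnM.
Qed.

Lemma ffact_le_exp n m : n ^_ m <= n ^ m.
Proof.
by elim: m => // m IH; rewrite ffactnSr expnSr leq_mul // leq_subr.
Qed.

Lemma bin_selfexp_le n m : 'C(n, m) * m ^ m <= (4 * n) ^ m.
Proof.
apply: leq_trans (leq_mul (leqnn _) (selfexp_le m)) _.
by rewrite mulnCA bin_ffact expnMn leq_mul // ffact_le_exp.
Qed.

Lemma superset_of_card (V : finType) (S : {set V}) m : #|S| <= m <= #|V| ->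
  exists2 W : {set V}, S \subset W & #|W| = m.
Proof.
case/andP=> + mV; elim: {S}_.+1 {-2}S (ltnSn (m - #|S|)) => // d IH S dS Sm.
have [E|Sm'] := eqVneq #|S| m; first by exists S.
have {Sm'} Sm' : #|S| < m by rewrite ltn_neqAle Sm'.
have [x] : exists x, x \notin S.
  apply/existsP; rewrite -negb_forall; apply/negP => /forallP all.
  by move: (leq_trans Sm' mV); rewrite ltnNge (_ : S = setT) ?cardsT ?leqnn //; apply/setP => x; rewrite all inE.
move=> xS; have [|| W sW cW] := IH (x |: S); rewrite ?cardsU1 ?xS //; first by rewrite add1n; lia.
by exists W => //; apply: subset_trans sW; exact: subsetUr.
Qed.
End Counting.

Section Potential.
Import Order.TTheory GRing.Theory Num.Theory.
Local Open Scope ring_scope.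
Variables (V : finType) (R : realType) (g : R) (k : nat).
Hypothesis g_gt0 : 0 < g.
Implicit Types (A W F : {set V}) (out : {ffun V -> {set V}}).

Definition ratio a : R := (3 * a)%N%:R / g.

Definition factor a W (s : {set V}) : R :=
  if s \subset W then ratio a ^+ (4 - #|s|) else 0.

Definition weight a A W out : R := \prod_(x in A) factor a W (out x).

(* Were the ends of Maker's edges chosen at random, [weight a A W out] would
   bound the conditional probability that [A] finally has all its chosen
   neighbours in [W]. *)
Definition potential out : R :=
  \sum_(1 <= a < k.+1) \sum_(W : {set V} | #|W| == (3 * a)%N)
    \sum_(A : {set V} | (A \subset W) && (#|A| == a)) weight a A W out.

Lemma ratio_ge0 a : 0 <= ratio a.
Proof. by rewrite divr_ge0 // ltW. Qed.

Lemma factor_ge0 a W (s : {set V}) : 0 <= factor a W s.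
Proof. by rewrite /factor; case: ifP => // _; rewrite exprn_ge0 // ratio_ge0. Qed.

Lemma weight_ge0 a A W out : 0 <= weight a A W out.
Proof. by apply: prodr_ge0 => x _; exact: factor_ge0. Qed.

Lemma sum_factor_le a W F (s : {set V}) : #|W| = (3 * a)%N -> (#|s| < 4)%N -> [disjoint F & s] ->
  g <= #|F|%:R -> \sum_(u in F) factor a W (u |: s) <= #|F|%:R * factor a W s.
Proof.
move=> Wa s4 Fs gF; rewrite /factor; have [sW|sW] := boolP (s \subset W); last first.
  rewrite mulr0 big1 // => u _; rewrite subUset (negbTE sW) andbF //.
pose r := ratio a ^+ (4 - #|s|).-1.
have E : ratio a ^+ (4 - #|s|) = ratio a * r by rewrite /r -exprS prednK // subn_gt0.
apply: (@le_trans _ _ (\sum_(u in F :&: W) r)).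
  rewrite big_mkcond [leRHS]big_mkcond; apply: ler_sum => u _; rewrite inE.
  case: (boolP (u \in F)) => //= uF; rewrite subUset sub1set sW andbT.
  by case: (u \in W) => //; rewrite cardsU1 (disjointFr Fs uF) /r subnS.
have r0 : 0 <= r by rewrite exprn_ge0 // ratio_ge0.
rewrite sumr_const -[r *+ _]mulr_natl E mulrA ler_wpM2r //.
apply: (@le_trans _ _ (3 * a)%N%:R).
  by rewrite ler_nat -Wa; apply/subset_leq_card/subsetIr.
have -> : (3 * a)%N%:R = g * ratio a :> R by rewrite /ratio mulrC divfK // gt_eqF.
by rewrite ler_wpM2r // ratio_ge0.
Qed.

Lemma sum_weight_le a A W F out v : #|W| = (3 * a)%N -> (#|out v| < 4)%N ->
  [disjoint F & out v] -> g <= #|F|%:R ->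
  \sum_(u in F) weight a A W (add_out out v u) <= #|F|%:R * weight a A W out.
Proof.
move=> Wa s4 Fs gF; have [vA|vA] := boolP (v \in A); last first.
  rewrite mulr_natl -sumr_const; apply: ler_sum => u _.
  rewrite /weight le_eqVlt; apply/orP; left; apply/eqP/eq_bigr => x xA.
  by rewrite ffunE; case: eqP vA => // <-; rewrite xA.
rewrite /weight [X in _ <= _ * X](bigD1 v) //= mulrA.
under eq_bigr => u _.
  rewrite (bigD1 v) //= ffunE eqxx.
  under eq_bigr => x /andP[_ /negbTE xv] do rewrite ffunE xv.
  over.
rewrite -mulr_suml ler_wpM2r ?sum_factor_le //.
by apply: prodr_ge0 => x _; exact: factor_ge0.
Qed.

Lemma potential_step F out v : (#|out v| < 4)%N ->
  [disjoint F & out v] -> g <= #|F|%:R ->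
  exists2 u, u \in F & potential (add_out out v u) <= potential out.
Proof.
move=> s4 Fs gF; apply: contrapT => no.
have F0 : (0 < #|F|)%N by rewrite -(ltr0n R); exact: lt_le_trans gF.
have : \sum_(u in F) potential (add_out out v u) <= #|F|%:R * potential out.
  rewrite /potential exchange_big mulr_sumr; apply: ler_sum => a _ /=.
  rewrite exchange_big mulr_sumr; apply: ler_sum => W /eqP Wa /=.
  rewrite exchange_big mulr_sumr; apply: ler_sum => A _ /=.
  exact: sum_weight_le.
apply/negP; rewrite -ltNge mulr_natl -sumr_const.
have /card_gt0P[u0 u0F] := F0.
apply: ltr_sum => [|u uF]; first by apply/hasP; exists u0; rewrite ?mem_index_enum.
by rewrite ltNge; apply/negP => le; case: no; exists u.
Qed.

Lemma potential_expands out A : potential out < 1 -> (forall x, #|out x| = 4%N) ->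
  (3 * k <= #|V|)%N -> (0 < #|A| <= k)%N -> (3 * #|A| < #|A :|: \bigcup_(x in A) out x|)%N.
Proof.
move=> Pout out4 kV /andP[A0 Ak]; rewrite ltnNge; apply/negP => small.
have [W sW cW] : exists2 W : {set V}, A :|: \bigcup_(x in A) out x \subset W & #|W| = (3 * #|A|)%N.
  apply: superset_of_card; rewrite small; apply: leq_trans kV; by rewrite leq_mul2l.
move: Pout; apply/negP; rewrite -leNgt /potential.
rewrite (bigD1_seq #|A|) ?iota_uniq ?mem_index_iota ?A0 //=.
rewrite (bigD1 W) ?cW //= (bigD1 A) /=; last first.
  by rewrite eqxx andbT; move: sW; rewrite subUset => /andP[].
have -> : weight #|A| A W out = 1.
  rewrite /weight big1 // => x xA; rewrite /factor out4 subnn expr0 ifT //.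
  by apply: subset_trans sW; apply: subset_trans (subsetUr _ _); exact: bigcup_sup.
rewrite -!addrA lerDl !addr_ge0 //; do ?[apply: sumr_ge0 => * ]; exact: weight_ge0.
Qed.

Lemma potential_init : (3072 * #|V| ^ 3 * k)%N%:R <= g ^+ 4 ->
  potential [ffun _ => set0] < 1.
Proof.
move=> hg.
have term a : (1 <= a <= k)%N ->
  \sum_(W : {set V} | #|W| == (3 * a)%N)
    \sum_(A : {set V} | (A \subset W) && (#|A| == a)) weight a A W [ffun _ => set0] <= 2^-1 ^+ a.
  case/andP=> a0 ak.
  have w A W : #|A| = a -> weight a A W [ffun _ => set0] = ratio a ^+ (4 * a).
    move=> Aa; rewrite /weight (eq_bigr (fun _ => ratio a ^+ 4)) => [|x _]; last first.
      by rewrite ffunE /factor sub0set cards0.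
    by rewrite prodr_const Aa exprM.
  apply: (@le_trans _ _ (('C(#|V|, 3 * a) * 2 ^ (3 * a))%N%:R * ratio a ^+ (4 * a))).
    rewrite natrM -mulrA mulr_natl -card_draws -sumr_const.
    rewrite [leRHS](eq_bigl (fun W : {set V} => #|W| == (3 * a)%N)) => [|W]; last by rewrite inE.
    apply: ler_sum => W /eqP Wa; rewrite -Wa -card_powerset mulr_natl -sumr_const.
    rewrite big_mkcond [leRHS]big_mkcond; apply: ler_sum => A _; rewrite inE.
    by case: (A \subset W) => //=; case: eqP => [/w->//|_]; rewrite exprn_ge0 // ratio_ge0.
  have count : ('C(#|V|, 3 * a) * 2 ^ (3 * a) * (3 * a) ^ (4 * a) <= (1536 * #|V| ^ 3 * a) ^ a)%N.
    have -> : (4 * a = 3 * a + a)%N by lia.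
    have -> : (1536 * #|V| ^ 3 * a = (4 * #|V|) ^ 3 * (3 * a) * 2 ^ 3)%N by rewrite expnMn; lia.
    rewrite (expnMn (_ ^ 3 * _)) (expnMn (_ ^ 3)) -!expnM expnD.
    move: (bin_selfexp_le #|V| (3 * a)); set c := 'C(_, _).
    set x := ((3 * a) ^ (3 * a))%N; set y := ((3 * a) ^ a)%N; set z := (2 ^ _)%N; set t := ((4 * _) ^ _)%N.
    move=> /(leq_mul (leqnn (y * z))).
    have -> : (y * z * (c * x) = c * z * (x * y))%N by ring.
    by have -> : (y * z * t = t * y * z)%N by ring.
  apply: (@le_trans _ _ (((1536 * #|V| ^ 3 * a)%N%:R / g ^+ 4) ^+ a)).
    rewrite /ratio !expr_div_n -exprM mulrA ler_wpM2r ?invr_ge0 ?exprn_ge0 ?(ltW g_gt0) //.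
    by rewrite -!natrX -natrM ler_nat.
  rewrite lerXn2r ?nnegrE ?divr_ge0 ?exprn_ge0 ?(ltW g_gt0) ?invr_ge0 //.
  rewrite ler_pdivrMr ?exprn_gt0 // ler_pdivlMl ?ltr0n //.
  by apply: le_trans hg; rewrite -natrM ler_nat !mulnA leq_mul.
have half : \sum_(1 <= a < k.+1) (2^-1 : R) ^+ a = 1 - 2^-1 ^+ k.
  elim: (k) => [|j IH]; first by rewrite big_nil expr0 subrr.
  by rewrite big_nat_recr //= IH exprSr; lra.
apply: (@le_lt_trans _ _ (\sum_(1 <= a < k.+1) (2^-1 : R) ^+ a)).
  rewrite /potential !big_seq; apply: ler_sum => a; rewrite mem_index_iota; exact: term.
by rewrite half gtrBl exprn_gt0 // invr_gt0.
Qed.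
End Potential.

(** * The opening *)

Section Opening.
Import Order.TTheory GRing.Theory Num.Theory.
Local Open Scope ring_scope.
Variables (V : finType) (R : realType) (H : {set {set V}}) (b m k : nat).
Variables (f1 f2 : nat -> R) (g : R).
Hypotheses (sH : H \subset complete_edges V) (m_gt0 : (0 < m)%N) (f12 : f1 m <= f2 m).
Hypothesis f1S : forall j, (m <= j)%N -> (2 * b.+1)%N%:R <= j%:R * (f1 j - f1 j.+1).
Hypothesis f2S : forall j, (0 < j < m)%N ->
  1 + (b.+2)%:R / j.+1%:R <= f2 j - f2 j.+1.
Hypotheses (g_gt0 : 0 < g) (k_gt1 : (1 < k)%N) (kV : (3 * k <= #|V|)%N).
Hypothesis enough_free : f2 1 + (8 * b.+1)%N%:R + b%:R + 1 + g <= #|V|%:R.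
Implicit Types (M B D C X : {set {set V}}) (out : {ffun V -> {set V}}).

Lemma free_neighbors X v :
  (#|V| <= 1 + degree X v + #|[set u | (u != v) && ([set v; u] \notin X)]|)%N.
Proof.
have hZ : {in [set u | [set v; u] \in X], forall u, [set v; u] \in X}.
  by move=> u; rewrite inE.
apply: (@leq_trans #|v |: ([set u | [set v; u] \in X] :|:
    [set u | (u != v) && ([set v; u] \notin X)])|).
  rewrite -cardsT; apply/subset_leq_card/subsetP => u _; rewrite !inE.
  by case: (u == v) => //=; exact: orbN.
apply: leq_trans (cardsU_le _ _) _; rewrite cards1 -addnA leq_add2l.
by apply: leq_trans (cardsU_le _ _) _; rewrite leq_add2r star_degree.
Qed.

Lemma expander_of_out M out : (forall v u, u \in out v -> adjacent M v u) ->
  (forall v, #|out v| = 4) -> potential g k out < 1 -> expander M k.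
Proof.
move=> outM out4 pot A Ak; have := potential_expands g_gt0 pot out4 kV Ak.
move=> /leq_trans; apply.
apply/subset_leq_card/setUS/bigcupsP => x xA; apply/subsetP => u /outM xu.
by rewrite inE; apply/exists_inP; exists x.
Qed.

Lemma opening r M B out : B \subset complete_edges V -> M \subset complete_edges V ->
  (\sum_v (4 - #|out v|) = r)%N -> (forall v, #|out v| <= 4)%N ->
  (forall v u, u \in out v -> adjacent M v u) ->
  potential g k out < 1 -> safe b m f1 f2 (H :|: M :|: B) out ->
  (2 * (#|H| + #|B| + b * (r + (2 * #|V|.-1).+1)) < k.+1 * k.+1)%N ->
  maker_forces (complete_edges V :\: H) b (@has_hamiltonian_cycle V)
    (r + (2 * #|V|.-1).+1) M B.
Proof.
elim: r M B out => [|r IH] M B out sB sM outr out4 outM pot saf bud.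
  have ex : expander M k.
    apply: expander_of_out pot => // v; apply/eqP; rewrite eqn_leq out4 /=.
    by rewrite -subn_eq0; move/eqP: outr; rewrite sum_nat_eq0 => /forallP/(_ v).
  have V0 : (0 < #|V|)%N by lia.
  have dV : (#|V|.-1 < #|V|)%N by rewrite ltn_predL.
  have [hp _] := endgame b sH k_gt1 sB ex dV.
  apply: hp => //; have /card_gt0P[x _] := V0.
  by exists [:: x]; split=> //=; rewrite -subn1 subKn.
have [v0 v0a] : exists v0, v0 \in active out.
  apply/existsP; apply: contraPT outr; rewrite negb_exists => /forallP all.
  rewrite big1 // => v _; apply/eqP; rewrite subn_eq0.
  by have := all v; rewrite inE -leqNgt.
rewrite addSn; right => D Dm; have [sD Db cD] := breaker_moveP Dm.
set C := H :|: M :|: B in saf.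
have sC : C \subset complete_edges V by rewrite !subUset sH sM sB.
have [v va vmax] : exists2 v, v \in active out &
    {in active out, forall x, danger R b (C :|: D) out x <= danger R b (C :|: D) out v}.
  exists [arg max_(x > v0 in active out) danger R b (C :|: D) out x]%O;
    by case: Order.TotalTheory.arg_maxP => // v va vmax x; exact: vmax.
pose F := [set u | (u != v) && ([set v; u] \notin C :|: D)].
have gF : g <= #|F|%:R.
  have h1 := safe_degree m_gt0 saf va.
  have h2 : (#|V| <= 1 + (degree C v + b) + #|F|)%N.
    apply: leq_trans (free_neighbors (C :|: D) v) _; rewrite leq_add2r leq_add2l.
    apply: leq_trans (degreeU _ _ _) _; rewrite leq_add2l; apply: leq_trans Db.
    by apply/subset_leq_card/subsetP => e; rewrite inE => /andP[].
  by move: h2; rewrite -(ler_nat R) !natrD; move: enough_free; lra.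
have dF : [disjoint F & out v].
  rewrite disjoint_subset; apply/subsetP => u; rewrite !inE => /andP[_].
  by apply: contra => /outM/andP[_ ->]; rewrite orbT.
have v4 : (#|out v| < 4)%N by move: va; rewrite inE.
have [u uF pu] := potential_step k g_gt0 v4 dF gF.
move: (uF); rewrite inE => /andP[uv euX].
have uo : u \notin out v by rewrite (disjointFr dF uF).
have ec : [set v; u] \in complete_edges V by rewrite edge_complete // eq_sym.
exists [set v; u].
  apply: unclaimedP => //; first by apply: contraNN euX; rewrite !inE => /orP[->|/orP[]->]; rewrite ?orbT.
  by apply: contraNN euX; rewrite !inE => ->; rewrite ?orbT.
apply: (IH _ _ (add_out out v u)).
- by rewrite subUset sB.
- by rewrite subUset sub1set ec.
- apply: succn_inj; rewrite -outr (bigD1 v) //= [RHS](bigD1 v) //= card_add_out // eqxx.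
  rewrite -addSn add1n; congr addn; first by rewrite subnSK.
  by apply: eq_bigr => x /negbTE xv; rewrite card_add_out // xv.
- by move=> x; rewrite card_add_out //; case: eqP => [->|_]; [exact: v4|exact: out4].
- move=> x y; rewrite ffunE; case: eqP => [->|_ /outM]; last first.
    by apply: sub_adjacent; exact: subsetUr.
  rewrite in_setU1 => /orP[/eqP->|/outM].
    by rewrite /adjacent eq_sym uv !inE eqxx.
  by apply: sub_adjacent; exact: subsetUr.
- exact: le_lt_trans pu pot.
- rewrite (_ : _ :|: _ = [set v; u] |: (C :|: D)).
    by apply: safe_step => // x xa; exact: vmax.
  by rewrite /C; apply/setP => e; rewrite !inE; do !case: (e \in _); rewrite ?orbT ?orbF.
- by apply: budget bud; apply: leq_trans (cardsU_le _ _) _; rewrite leq_add2l.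
Qed.

Lemma maker_wins :
  (forall j, (m <= j <= #|V|)%N -> (max_degree H)%:R <= f1 j) ->
  (forall j, (0 < j <= m)%N -> (max_degree H)%:R <= f2 j) ->
  (3072 * #|V| ^ 3 * k)%N%:R <= g ^+ 4 ->
  (2 * (#|H| + b * (7 * #|V|)) < k.+1 * k.+1)%N ->
  maker_can_build_within (complete_edges V :\: H) b (@has_hamiltonian_cycle V) (7 * #|V|).
Proof.
move=> d1 d2 hg bud.
have V0 : (0 < #|V|)%N by lia.
have moves : (4 * #|V| + (2 * #|V|.-1).+1 <= 7 * #|V|)%N by lia.
apply: (maker_forces_leq moves); apply: (opening (out := [ffun _ => set0])).
- exact: sub0set.
- exact: sub0set.
- rewrite (eq_bigr (fun _ => 4%N)) => [|v _]; last by rewrite ffunE cards0.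
  by rewrite sum_nat_const mulnC.
- by move=> v; rewrite ffunE cards0.
- by move=> v u; rewrite ffunE inE.
- exact: potential_init.
- rewrite !setU0; exact: safe_init d1 d2.
- apply: leq_ltn_trans bud; rewrite cards0 addn0 leq_mul2l /= leq_add2l.
  by rewrite leq_mul2l moves orbT.
Qed.

End Opening.

(** * Asymptotics *)

Section Asymptotics.
Import Order.TTheory GRing.Theory Num.Theory.
Local Open Scope ring_scope.
Variable R : realType.

Lemma ln_succ_ge j : (0 < j)%N -> j.+1%:R^-1 <= ln (j.+1%:R : R) - ln j%:R.
Proof.
move=> j0; have j1 : (0 : R) < j%:R by rewrite ltr0n.
have j2 : (0 : R) < j.+1%:R by rewrite ltr0n.
rewrite -opprB lerNr -ln_div ?posrE //.
have -> : j%:R / j.+1%:R = 1 + - j.+1%:R^-1 :> R.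
  by rewrite -natr1; field; rewrite ?nat1r ?natr1 pnatr_eq0.
apply: le_ln1Dx; rewrite ltrN2 invf_lt1 // ltr1n //.
Qed.

Lemma ln_sqr_le (x : R) : 1 <= x -> ln x ^+ 2 / 4 <= x.
Proof.
move=> x1; have x0 : 0 < x by apply: lt_le_trans x1.
have l0 := ln_ge0 x1.
rewrite -[leRHS](lnK (x := x)) ?posrE //.
have -> : ln x = ln x / 2 + ln x / 2 by field.
rewrite expRD; have := expR_ge1Dx (ln x / 2); set u := ln x / 2; set v := sequences.expR u => uv.
have u0 : 0 <= u by rewrite /u divr_ge0.
have : u * u <= v * v by apply: ler_pM => //; lra.
by rewrite expr2; lra.
Qed.

Lemma free_bound (e N L b y : R) : 0 < e -> e <= 1 -> y = e / 8 -> 8 * (2 / y + 9) <= e * L ->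
  64 <= e * L -> L ^+ 2 / 4 <= N -> L <= N -> b * L <= (1 - e) * N -> 0 <= b -> 0 < L ->
  y * N + 2 * (b + 1) / y + y * N + (b + 2) * L + 9 * (b + 1) + y * N <= N.
Proof.
move=> e0 e1 yE; set c := 2 / y + 9 => cL eL LN L1 bL b0 L0.
have -> : 2 * (b + 1) / y = (b + 1) * (c - 9) by rewrite /c; lra.
have N0 : 0 < N by apply: lt_le_trans L1.
have h1 : b * (8 * c) <= b * (e * L) by rewrite ler_wpM2l.
have h2 : e * (b * L) <= e * ((1 - e) * N) by rewrite ler_wpM2l // ltW.
have h3 : 0 <= e * (e * N) by rewrite !mulr_ge0 // ltW.
have h4 : e * L <= e * N by rewrite ler_wpM2l // ltW.
have h5 : 64 * L <= e * L * L by rewrite ler_wpM2r // ltW.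
have h6 : e * (L ^+ 2 / 4) <= e * N by rewrite ler_wpM2l // ltW.
rewrite yE; lra.
Qed.

End Asymptotics.

Import Order.TTheory GRing.Theory Num.Theory.
Local Open Scope ring_scope.

Theorem theorem2p5 (R : realType) :
  exists K : nat,
  forall eps : R, 0 < eps ->
  exists2 delta : R, 0 < delta &
  exists n0 : nat,
  forall (n : nat) (H : {set {set 'I_n}}),
    (n0 <= n)%N ->
    is_graph H ->
    (max_degree H)%:R <= delta * n%:R ->
    #|H|%:R <= n%:R ^+ 2 / ln (n%:R : R) ->
  forall b : nat, (0 < b)%N ->
    b%:R <= (1 - eps) * (n%:R / ln (n%:R : R)) ->
    maker_can_build_within (complete_edges 'I_n :\: H) b
      (@has_hamiltonian_cycle 'I_n) (K * n)%N.
Proof.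
exists 7%N => eps eps0.
pose e : R := Num.min eps (2^-1).
have e0 : 0 < e by rewrite lt_min eps0 invr_gt0 ltr0n.
have eeps : e <= eps by rewrite ge_min lexx.
have e2 : e <= 2^-1 by rewrite ge_min lexx orbT.
pose y : R := e / 8; have y0 : 0 < y by rewrite divr_gt0 ?ltr0n.
pose a : R := y ^+ 4 / 3072; have a0 : 0 < a by rewrite divr_gt0 ?exprn_gt0 ?ltr0n.
have a3 : 3 * a <= 1.
  have : y ^+ 4 <= 1 by rewrite exprn_ile1 // /y; lra.
  by rewrite /a; lra.
exists y => //.
pose t1 := 8 * (2 / y + 9) / e; pose t2 := 64 / e; pose t3 := 17 / a ^+ 2; pose t4 := 3 / a.
have t1_ge0 : 0 <= t1 by rewrite divr_ge0 ?mulr_ge0 ?addr_ge0 ?divr_ge0 // ltW.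
have t2_ge0 : 0 <= t2 by rewrite divr_ge0 // ltW.
have t3_ge0 : 0 <= t3 by rewrite divr_ge0 // exprn_ge0 // ltW.
have t4_ge0 : 0 <= t4 by rewrite divr_ge0 // ltW.
pose L0 := 4 + t1 + t2 + t3 + t4.
exists (Num.truncn (sequences.expR L0)).+1 => n H n0 gH dH eH b b0 bb.
set N : R := n%:R in dH eH bb *; set L := ln N in eH bb *.
have NL0 : sequences.expR L0 <= N.
  by apply: le_trans (ltW (truncnS_gt _)) _; rewrite ler_nat.
have N0 : 0 < N by apply: lt_le_trans NL0; exact: expR_gt0.
have L0L : L0 <= L by rewrite -[L0]expRK ler_ln // posrE ?expR_gt0.
have N1 : 1 <= N by apply: le_trans NL0; apply: le_trans (expR_ge1Dx _); rewrite lerDl /L0; lra.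
have L_gt0 : 0 < L by move: L0L; rewrite /L0; lra.
have L4 : 4 <= L by move: L0L; rewrite /L0; lra.
have LN2 := ln_sqr_le N1; rewrite -/L in LN2.
have LN : L <= N.
  by apply: le_trans LN2; have := ler_wpM2l (ltW L_gt0) L4; rewrite expr2; lra.
have h1 : 8 * (2 / y + 9) <= e * L.
  by rewrite [e * L]mulrC -ler_pdivrMr // -/t1; move: L0L; rewrite /L0; lra.
have h2 : 64 <= e * L by rewrite mulrC -ler_pdivrMr // -/t2; move: L0L; rewrite /L0; lra.
have h3 : 17 <= a ^+ 2 * L.
  by rewrite mulrC -ler_pdivrMr ?exprn_gt0 // -/t3; move: L0L; rewrite /L0; lra.
have h4 : 3 <= a * N.
  by rewrite mulrC -ler_pdivrMr // -/t4; apply: le_trans LN; move: L0L; rewrite /L0; lra.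
have bL : b%:R * L <= (1 - e) * N.
  apply: (@le_trans _ _ ((1 - eps) * N)); last by apply: ler_wpM2r; [exact: ltW|rewrite lerD2l lerN2].
  by rewrite -ler_pdivlMr // -mulrA.
pose m := (Num.truncn (y * N)).+1; pose k := Num.truncn (a * N).
have yN0 : 0 < y * N by rewrite mulr_gt0.
have mle : (Num.truncn (y * N))%:R <= y * N by rewrite truncn_le ltW.
have mgt : y * N < m%:R by exact: truncnS_gt.
have kle : k%:R <= a * N by rewrite truncn_le mulr_ge0 // ltW.
have kgt : a * N < k%:R + 1 by rewrite natr1; exact: truncnS_gt.
have m0 : (0 : R) < m%:R by rewrite ltr0n.
have mN : m%:R <= N.
  rewrite /m -natr1; apply: le_trans (lerD mle (lexx _)) _; rewrite /y.
  have := ler_wpM2r (ltW N0) e2; lra.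
(* As [m] is linear in [n], sets of at least [m] vertices contribute only O(b)
   to the danger, and smaller ones b ln n + m. *)
pose s : R := (2 * b.+1)%N%:R.
pose f1 j : R := y * N + (N - j%:R) * (s / m%:R).
pose f2 j : R := f1 m + (m%:R - j%:R) + (b.+2)%:R * (ln m%:R - ln j%:R).
have sm0 : 0 <= s / m%:R by rewrite divr_ge0.
have f1y j : (j <= n)%N -> y * N <= f1 j.
  by move=> jn; rewrite /f1 lerDl mulr_ge0 // subr_ge0 ler_nat.
have mn : (m <= n)%N by rewrite -(ler_nat R).
have f2y j : (0 < j <= m)%N -> y * N <= f2 j.
  case/andP=> j0 jm; rewrite /f2 -addrA; apply: le_trans (f1y _ mn) _.
  rewrite lerDl addr_ge0 // ?subr_ge0 ?ler_nat // mulr_ge0 // subr_ge0.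
  by rewrite ler_ln ?posrE ?ltr0n // ler_nat.
rewrite -[n in (7 * n)%N]card_ord.
apply: (@maker_wins _ R H b m k f1 f2 (y * N)) => //; rewrite ?card_ord.
- by rewrite /f2 !subrr mulr0 !addr0.
- move=> j mj; rewrite /f1 -/s -natr1.
  have -> : y * N + (N - j%:R) * (s / m%:R) - (y * N + (N - (j%:R + 1)) * (s / m%:R)) = s / m%:R by ring.
  rewrite mulrCA ler_peMr // ler_pdivlMr // mul1r ler_nat //.
- move=> j /andP[j0 _]; rewrite /f2.
  have := ler_wpM2l (ler0n R b.+2) (ln_succ_ge R j0).
  set i := _^-1; set l1 := ln j.+1%:R; set l := ln j%:R; set l0 := ln _; set f := f1 m.
  by move: i l1 l l0 f => i l1 l l0 f; rewrite -(natr1 j); lra.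
- by rewrite -(ltr_nat R) -(ltrD2r 1); apply: le_lt_trans kgt; apply: le_trans h4; lra.
- by rewrite -(ler_nat R) natrM -/N; have := ler_wpM2r (ltW N0) a3; lra.
- have yE : y = e / 8 by [].
  have h := free_bound e0 (le_trans e2 _) yE h1 h2 LN2 LN bL (ler0n _ _) L_gt0.
  rewrite -/N; apply: le_trans (h _); last by rewrite invf_le1 // ler1n.
  rewrite lerD2r /f2 /f1.
  have hs : (N - m%:R) * (s / m%:R) <= 2 * (b%:R + 1) / y.
    apply: (@le_trans _ _ (N * (s / m%:R))).
      by apply: ler_wpM2r => //; rewrite lerBlDr lerDl ltW.
    have -> : s = 2 * (b%:R + 1) by rewrite /s natrM natr1.
    rewrite mulrCA; apply: ler_wpM2l; first by rewrite mulr_ge0 // addr_ge0.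
    by rewrite ler_pdivrMr // ler_pdivlMl // ltW.
  have hL : b.+2%:R * (ln m%:R - ln 1%:R) <= (b%:R + 2) * L.
    rewrite ln1 subr0 -(addn2 b) natrD; apply: ler_wpM2l; first by rewrite addr_ge0.
    by rewrite ler_ln.
  have hm : m%:R - 1 <= y * N by rewrite /m -natr1 addrK.
  have -> : (8 * b.+1)%N%:R = 8 * (b%:R + 1) :> R by rewrite natrM natr1.
  move: hs hL hm; set p := _ * (s / _); set q := _ * (ln _ - _).
  by move: p q => p q; lra.
- by move=> j /andP[_ jn]; apply: le_trans dH (f1y _ jn).
- by move=> j jm; apply: le_trans dH (f2y _ jm).
- rewrite (natrM _ (3072 * _)) (natrM _ 3072) (natrX _ n 3) -/N.
  have -> : (y * N) ^+ 4 = 3072 * N ^+ 3 * (a * N).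
    by rewrite /a; field.
  by apply: ler_wpM2l kle; rewrite mulr_ge0 // exprn_ge0 // ltW.
- rewrite -(ltr_nat R) !natrM natrD !natrM -/N -(natr1 k).
  apply: (@lt_trans _ _ ((a * N) * (a * N))); last first.
    by apply: ltr_pM => //; apply: mulr_ge0; exact: ltW.
  rewrite -(ltr_pM2l L_gt0); rewrite ler_pdivlMr // in eH.
  have NN : 0 < N * N by rewrite mulr_gt0.
  have h5 := ler_wpM2r (ltW NN) h3.
  have bN : b%:R * L * N <= N * N.
    apply: ler_wpM2r; first exact: ltW.
    by apply: le_trans bL _; rewrite ler_piMl ?ltW // gtrBl.
  by move: NN h5 bN eH; rewrite !expr2; lra.
Qed.
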